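(* Let $q$ be a prime power and $\ell_\infty$ a line of $\mathrm{PG}(2,q^3)$. Then: (1) for a given tangent splash of $\ell_\infty$, the number of order-$q$-subplanes meeting $\ell_\infty$ in exactly one point and having that tangent splash is $q^6(q^3-1)$; (2) the number of tangent splashes of $\ell_\infty$ is $q(q^3+1)(q^2+q+1)$; (3) for a given point $T\in\ell_\infty$, the number of tangent splashes of $\ell_\infty$ with centre $T$ is $q(q^2+q+1)$.
   Context: An order-$q$-subplane of $\mathrm{PG}(2,q^3)$ is a subplane of order $q$ (an image of $\mathrm{PG}(2,q)$ under $\mathrm{PGL}(3,q^3)$). If $\pi$ is an order-$q$-subplane meeting $\ell_\infty$ in exactly one point $T$, its tangent splash is the set of $q^2+1$ points of $\ell_\infty$ lying on the extension of some line of $\pi$; $T$ is its centre. A tangent splash of $\ell_\infty$ is any set arising this way. *)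

(* Defs.v *)
From HB Require Import structures.
From mathcomp Require Import all_boot all_order all_algebra.
Set Implicit Arguments. Unset Strict Implicit. Unset Printing Implicit Defensive.
Import GRing.Theory.
Local Open Scope ring_scope.

Section Plane.

Variable F : finFieldType.

(* PG(2, F) is the lattice of subspaces of F^3.  A subspace is represented by
   the unique matrix U with that row space such that <<U>> = U, so that equal
   subspaces are equal matrices; incidence is (P <= m)%MS. *)
Definition pg_subspaces (k : nat) : {set 'M[F]_3} :=
  [set U | (<<U>>%MS == U) && (\rank U == k)].

Definition pg_points := pg_subspaces 1.
Definition pg_lines := pg_subspaces 2.

Definition collineation (g U : 'M[F]_3) : 'M[F]_3 := <<U *m g>>%MS.

(* A subplane carries its points and its lines, each line being stored as its
   extension to a line of PG(2, F).  The second component is determined by the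
   first, so counting pairs amounts to counting point sets. *)
Definition subplane := ({set 'M[F]_3} * {set 'M[F]_3})%type.

Implicit Types (q : nat) (l T : 'M[F]_3) (pi : subplane).

(* When #|F| = q ^ 3, the subfield GF(q) is {x | x ^+ q = x}.  U is defined
   over GF(q) when it is the F-span of a subspace of GF(q)^3; this extension
   of scalars is injective and preserves dimension and incidence. *)
Definition defined_over q (U : 'M[F]_3) : bool :=
  [exists B : 'M[F]_3, [forall i, forall j, B i j ^+ q == B i j]
                       && (U == <<B>>%MS)].

Definition PG2 q : subplane :=
  ([set P in pg_points | defined_over q P],
   [set m in pg_lines | defined_over q m]).

(* Images of PG(2, q) under PGL(3, F): scalar matrices act trivially, so g may
   range over all invertible matrices. *)
Definition order_subplanes q : {set subplane} :=
  [set (collineation g @: (PG2 q).1, collineation g @: (PG2 q).2) | g : 'M[F]_3 in unitmx].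

Definition meet l pi : {set 'M[F]_3} := [set P in pi.1 | (P <= l)%MS].

Definition tangent_subplanes q l : {set subplane} :=
  [set pi in order_subplanes q | #|meet l pi| == 1%N].

Definition splash l pi : {set 'M[F]_3} :=
  [set P in pg_points | (P <= l)%MS && [exists m in pi.2, (P <= m)%MS]].

Definition tangent_splashes q l : {set {set 'M[F]_3}} :=
  [set splash l pi | pi in tangent_subplanes q l].

Definition tangent_splashes_with_centre q l T : {set {set 'M[F]_3}} :=
  [set splash l pi | pi in tangent_subplanes q l & meet l pi == [set T]].

End Plane.

(* Main.v *)
(* Let K = GF(q) in F = GF(q^3).  Choose coordinates of PG(2, F) in which l is
   z = 0 and the centre is T = (1, 0, 0).  If h is the matrix such that the lines
   of a subplane are the columns h n with n rational over K, then tangency at T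
   allows h to be normalised, by a scalar on the left and a rational matrix on the
   right, to

     | 1 0 0 |
     | v a b |   with a, b independent over K and a s <> b r.
     | t r s |

   The splash then consists of T and of the points (- c, 1, 0) for c in the coset
   v + K a + K b, whatever (t, r, s) is, while distinct triples (t, r, s) give
   distinct subplanes; there are q^3 (q^6 - q^3) of these triples.  Splashes with
   centre T thus correspond to the q (q^2 + q + 1) cosets of planes of F over K.

   A splash determines its centre: otherwise, with (0, 1, 0) as second centre,
   some plane W and the set of inverses of its elements would both be K-subspaces,
   and b / a would be quadratic over K, whereas elements of F \ K have degree 3. *)

Require Import Defs.
From HB Require Import structures.
From mathcomp Require Import all_boot all_order all_algebra all_field.
From mathcomp Require Import ring.

(** * The Frobenius map of order 3 and its fixed field of order [q] *)

Section FrobeniusFixedField.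

Import GRing.Theory.
Local Open Scope ring_scope.
Set Implicit Arguments.
Unset Strict Implicit.
Unset Printing Implicit Defensive.

Variables (F : finFieldType) (q : nat).
Hypothesis q_prime_power : exists p k : nat, [/\ prime p, (0 < k)%N & q = (p ^ k)%N].
Hypothesis cardF : #|F| = (q ^ 3)%N.

Lemma base_order_pnat : exists2 p, p \in [pchar F] & p.-nat q.
Proof.
have [p [k [pp k0 qE]]] := q_prime_power.
exists p; last by rewrite qE pnatX pnat_id.
apply: (@card_finPcharP F p (k * 3)) => //.
by rewrite cardF qE expnM.
Qed.

Lemma base_order_gt1 : (1 < q)%N.
Proof.
have [p [k [pp k0 ->]]] := q_prime_power.
by rewrite -{1}(exp1n k) ltn_exp2r // prime_gt1.
Qed.

(** Since [q] is a power of the characteristic, raising to the power [q] is additive. Packing it as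
    a ring morphism gives access to the compatibility of [map_mx] with the operations on
    matrices. *)
Lemma exists_base_frobenius : exists phi : {rmorphism F -> F}, forall x, phi x = x ^+ q.
Proof.
have [p pF qp] := base_order_pnat.
have fD : zmod_morphism (fun x : F => x ^+ q).
  move=> x y /=; rewrite GRing.exprDn_pchar ?GRing.exprNn_pchar //.
  by rewrite (eq_pnat _ (GRing.pcharf_eq pF)).
  by rewrite (eq_pnat _ (GRing.pcharf_eq pF)).
have fM : monoid_morphism (fun x : F => x ^+ q).
  by split=> [|x y]; rewrite ?expr1n ?exprMn.
pose phi : {rmorphism F -> F} := HB.pack (fun x : F => x ^+ q)
  (GRing.isZmodMorphism.Build _ _ _ fD) (GRing.isMonoidMorphism.Build _ _ _ fM).
by exists phi.
Qed.

Lemma expf_base_order3 (x : F) : x ^+ q ^+ q ^+ q = x.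
Proof. by rewrite -!exprM -[RHS]expf_card cardF !expnS muln1 mulnA. Qed.

(* [X^(q^3) - X = (X^q - X)^(q^2) + (X^q - X)^q + (X^q - X)] splits with simple
   roots, hence so does its factor [X^q - X]. *)
Lemma card_base_field : #|[set x : F | x ^+ q == x]| = q.
Proof.
have q1 := base_order_gt1; have q0 : (0 < q)%N by exact: ltnW.
have [p pF qp] := base_order_pnat.
set K := [set x | _]; pose P : {poly F} := 'X^q - 'X.
have sP : size P = q.+1.
  by rewrite size_polyDl ?size_polyXn // size_polyN size_polyX ltnS.
have P0 : P != 0 by rewrite -size_poly_eq0 sP.
have qpn : [pchar {poly F}].-nat q.
  rewrite (eq_pnat _ (pchar_poly F)).
  by rewrite (eq_pnat _ (GRing.pcharf_eq pF)).
have frobB (A B : {poly F}) : (A - B) ^+ q = A ^+ q - B ^+ q.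
  by rewrite GRing.exprDn_pchar ?GRing.exprNn_pchar.
have rootP x : root P x = (x \in K).
  by rewrite inE /root !hornerE subr_eq0.
have Pdvd : P %| \prod_(x <- enum F) ('X - x%:P).
  rewrite big_enum /= -finField_genPoly cardF.
  have -> : 'X^(q ^ 3) - 'X = P ^+ q ^+ q + P ^+ q + P.
    by rewrite !frobB -!exprM !expnS muln1 !mulnA !addrA !subrK.
  by rewrite dvdp_add ?dvdpp ?(dvdp_add (dvdp_exp q0 _) _) ?dvdp_exp.
have [m Pm] := dvdp_prod_XsubC Pdvd.
have sm : size (mask m (enum F)) = q.
  by apply: succn_inj; rewrite -sP (eqp_size Pm) size_prod_XsubC.
have um : uniq (mask m (enum F)) by rewrite mask_uniq ?enum_uniq.
apply/eqP; rewrite eqn_leq; apply/andP; split.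
  rewrite cardE -ltnS -sP; apply: max_poly_roots => //.
    by apply/allP=> x; rewrite mem_enum rootP.
  exact: enum_uniq.
rewrite -{1}sm -(card_uniqP um); apply: subset_leq_card.
by apply/subsetP=> x; rewrite -rootP (eqp_root Pm) root_prod_XsubC.
Qed.

End FrobeniusFixedField.

Section RationalPlanes.

Import GRing.Theory.
Local Open Scope ring_scope.
Set Implicit Arguments.
Unset Strict Implicit.
Unset Printing Implicit Defensive.

Variables (F : finFieldType) (q : nat) (phi : {rmorphism F -> F}).
Hypothesis phi_order3 : forall x, phi (phi (phi x)) = x.

(** * Linear independence over the fixed field [K] *)

Definition fixed_field := [set x | phi x == x].
Notation K := fixed_field.

Hypothesis cardF : #|F| = (q ^ 3)%N.
Hypothesis cardK : #|K| = q.

Lemma fixedP x : reflect (phi x = x) (x \in K).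
Proof. by rewrite inE; apply: eqP. Qed.

Lemma fixed0 : 0 \in K. Proof. by rewrite inE rmorph0. Qed.
Lemma fixed1 : 1 \in K. Proof. by rewrite inE rmorph1. Qed.
Lemma fixedD x y : x \in K -> y \in K -> x + y \in K.
Proof. by move=> /fixedP hx /fixedP hy; apply/fixedP; rewrite rmorphD hx hy. Qed.
Lemma fixedN x : x \in K -> - x \in K.
Proof. by move=> /fixedP hx; apply/fixedP; rewrite rmorphN hx. Qed.
Lemma fixedB x y : x \in K -> y \in K -> x - y \in K.
Proof. by move=> hx hy; rewrite fixedD ?fixedN. Qed.
Lemma fixedM x y : x \in K -> y \in K -> x * y \in K.
Proof. by move=> /fixedP hx /fixedP hy; apply/fixedP; rewrite rmorphM hx hy. Qed.
Lemma fixedV x : x \in K -> x^-1 \in K.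
Proof. by move=> /fixedP hx; apply/fixedP; rewrite fmorphV hx. Qed.
Lemma fixed_div x y : x \in K -> y \in K -> x / y \in K.
Proof. by move=> hx hy; rewrite fixedM ?fixedV. Qed.

(* Independence over [K]: when [a = 0] the quotient is [0], which lies in [K]. *)
Definition indep (a b : F) := b / a \notin K.

Lemma indep_eq0 a b x y : indep a b -> x \in K -> y \in K ->
  x * a + y * b = 0 -> x = 0 /\ y = 0.
Proof.
move=> ab xK yK e.
have a0 : a != 0 by apply: contraNneq ab => ->; rewrite invr0 mulr0 fixed0.
have y0 : y = 0.
  apply: contraNeq ab => y0; have -> : b = - (x * a) / y.
    by move/eqP: e; rewrite addrC addr_eq0 => /eqP<-; field.
  have -> : - (x * a) / y / a = - (x / y) by field; rewrite a0 y0.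
  by rewrite fixedN ?fixed_div.
split=> //; move: e; rewrite y0 mul0r addr0 => /eqP.
by rewrite mulf_eq0 (negPf a0) orbF => /eqP.
Qed.

Lemma indepNP a b : (forall x y, x \in K -> y \in K -> x * a + y * b = 0 ->
   x = 0 /\ y = 0) -> indep a b.
Proof.
move=> ab; apply/negP=> baK.
have [a0|a0] := eqVneq a 0.
  case: (ab 1 0 fixed1 fixed0); first by rewrite a0 mulr0 mul0r addr0.
  by move/eqP; rewrite oner_eq0.
case: (ab (b / a) (-1) baK _); rewrite ?fixedN ?fixed1 //.
  by rewrite divfK // mulN1r subrr.
by move=> _ /eqP; rewrite oppr_eq0 oner_eq0.
Qed.

(* A quadratic equation over [K] would make [c] a fixed point of the order-3
   map [phi]: the roots [c], [phi c] have their sum in [K], so that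
   [phi (phi c) = c]. *)
Lemma not_quadratic c x y z : c \notin K -> x \in K -> y \in K -> z \in K ->
  x + y * c + z * c ^+ 2 = 0 -> [/\ x = 0, y = 0 & z = 0].
Proof.
move=> cK xK yK zK e.
have [z0|z0] := eqVneq z 0.
  have c1 : indep 1 c by rewrite /indep divr1.
  have [-> ->] : x = 0 /\ y = 0; last by rewrite z0.
  by apply: (indep_eq0 c1) => //; rewrite mulr1 -[RHS]e z0 mul0r addr0.
have cc : c - phi c != 0 by apply: contraNneq cK => /eqP; rewrite subr_eq0 inE eq_sym.
have e' : x + y * phi c + z * phi c ^+ 2 = 0.
  move/fixedP: xK => {1}<-; move/fixedP: yK => {1}<-; move/fixedP: zK => {1}<-.
  by rewrite -rmorphXn -!rmorphM -!rmorphD e rmorph0.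
have s : c + phi c = - y / z.
  apply: (mulfI z0); apply: (mulfI cc); rewrite (_ : z * (- y / z) = - y); last by field.
  apply/eqP; rewrite -subr_eq0; apply/eqP.
  by rewrite -[RHS](subrr 0) -{1}e -e'; ring.
have s' : phi c + phi (phi c) = - y / z.
  by rewrite -rmorphD s; apply/fixedP; rewrite fixed_div ?fixedN.
have c2 : phi (phi c) = c.
  by apply: (addIr (phi c)); rewrite s -s' addrC.
by case/negP: cK; apply/fixedP; rewrite -{1}c2 phi_order3.
Qed.

(** * Cosets of the planes of [F] over [K] *)

Definition coset v a b := [set v + (xy.1 * a + xy.2 * b) | xy in setX K K].

Lemma cosetP v a b z :
  reflect (exists x y, [/\ x \in K, y \in K & z = v + (x * a + y * b)])
          (z \in coset v a b).
Proof.
apply: (iffP imsetP) => [[[x y]]|[x [y [xK yK ->]]]].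
  by rewrite inE /= => /andP[xK yK] ->; exists x, y.
by exists (x, y) => //; rewrite inE xK yK.
Qed.

Lemma card_coset v a b : indep a b -> #|coset v a b| = (q ^ 2)%N.
Proof.
move=> ab; rewrite card_in_imset ?cardsX ?cardK ?mulnn //.
move=> [x y] [x' y']; rewrite !inE /= => /andP[xK yK] /andP[xK' yK'] /addrI e.
have [] := @indep_eq0 a b (x - x') (y - y') ab.
- by rewrite fixedB ?inE.
- by rewrite fixedB ?inE.
- by transitivity (x * a + y * b - (x' * a + y' * b)); [ring | rewrite e subrr].
by move/eqP; rewrite subr_eq0 => /eqP-> /eqP; rewrite subr_eq0 => /eqP->.
Qed.

(** Both cosets have [q ^ 2] elements, so one inclusion is enough for equality. The criterion
    separates [v'] from the pair [(a', b')]: the triples describing a given coset form a product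
    set, which is easy to count. *)
Lemma coset_eqP v a b v' a' b' : indep a b -> indep a' b' ->
  (coset v' a' b' == coset v a b) =
  [&& v' \in coset v a b, a' \in coset 0 a b & b' \in coset 0 a b].
Proof.
move=> ab ab'; apply/eqP/and3P=> [e|[]].
  have vv : v' \in coset v a b.
    by rewrite -e; apply/cosetP; exists 0, 0; rewrite fixed0; split=> //; ring.
  have va : v' + a' \in coset v a b.
    by rewrite -e; apply/cosetP; exists 1, 0; rewrite fixed0 fixed1; split=> //; ring.
  have vb : v' + b' \in coset v a b.
    by rewrite -e; apply/cosetP; exists 0, 1; rewrite fixed0 fixed1; split=> //; ring.
  case/cosetP: (vv) => [x [y [xK yK ev]]].
  split=> //.
    case/cosetP: va => [x' [y' [xK' yK' ev']]]; apply/cosetP.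
    exists (x' - x), (y' - y); rewrite !fixedB //; split=> //.
    by apply: (addrI v'); rewrite ev' ev; ring.
  case/cosetP: vb => [x' [y' [xK' yK' ev']]]; apply/cosetP.
  exists (x' - x), (y' - y); rewrite !fixedB //; split=> //.
  by apply: (addrI v'); rewrite ev' ev; ring.
move=> /cosetP[x [y [xK yK ev]]] /cosetP[x1 [y1 [xK1 yK1 ea]]].
move=> /cosetP[x2 [y2 [xK2 yK2 eb]]].
apply/eqP; rewrite eqEcard !card_coset // leqnn andbT.
apply/subsetP=> z /cosetP[s [t [sK tK ->]]]; apply/cosetP.
exists (x + s * x1 + t * x2), (y + s * y1 + t * y2).
by split; rewrite ?(fixedD, fixedM) // ev ea eb; ring.
Qed.

(** Once a nonzero [a] is chosen in [W], the second element must avoid the [q] multiples of [a], all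
    of which lie in [W]. This is applied to [W = F] and to a plane over [K]. *)
Lemma card_indep_pairs (W : {set F}) : 0 \in W ->
    (forall x a, x \in K -> a \in W -> x * a \in W) ->
  #|[set ab in setX W W | indep ab.1 ab.2]| = ((#|W| - 1) * (#|W| - q))%N.
Proof.
move=> W0 WZ.
transitivity (\sum_(ab in setX W W) (indep ab.1 ab.2 : nat))%N.
  rewrite -sum1dep_card big_mkcondr /=; apply: eq_bigr => ab _.
  by case: indep.
rewrite (eq_bigl (fun ab => (ab.1 \in W) && (ab.2 \in W))); last by move=> ab; rewrite inE.
rewrite -(pair_big (mem W) (mem W) (fun a b => indep a b : nat)) /=.
rewrite (bigD1 0) //= big1 ?add0n; last first.
  by move=> b _; rewrite /indep invr0 mulr0 fixed0.
transitivity (\sum_(a in W | a != 0%R) (#|W| - q))%N.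
  apply: eq_bigr => a /andP[aW a0].
  have -> : q = #|[set x * a | x in K]| by rewrite card_imset ?cardK //; apply: mulIf.
  rewrite -[X in (X - _)%N](cardsID [set x * a | x in K] W) (setIidPr _); last first.
    by apply/subsetP=> _ /imsetP[x xK ->]; apply: WZ.
  rewrite addKn -sum1_card [LHS]big_mkcond [RHS]big_mkcond /=.
  apply: eq_bigr => b _; rewrite in_setD /indep.
  have -> : (b \in [set x * a | x in K]) = (b / a \in K).
    apply/imsetP/idP=> [[x xK ->]|baK]; first by rewrite mulfK.
    by exists (b / a); rewrite ?divfK.
  by rewrite andbC; case: (b \in W); case: (b / a \in K).
rewrite sum_nat_const; congr (_ * _)%N.
by rewrite (cardD1 0 W) W0 addKn; apply: eq_card => x; rewrite !inE andbC.
Qed.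

Definition cosets :=
  [set coset vab.1 vab.2.1 vab.2.2 | vab : F * (F * F) & indep vab.2.1 vab.2.2].

Hypothesis q_gt1 : (1 < q)%N.

(** Double counting of the triples [(v, a, b)] with [a], [b] independent: there are
    [q ^ 3 * ((q ^ 3 - 1) * (q ^ 3 - q))] of them, and each coset arises from
    [q ^ 2 * ((q ^ 2 - 1) * (q ^ 2 - q))]. *)
Lemma card_cosets : #|cosets| = (q * (q ^ 2 + q + 1))%N.
Proof.
set A := [set vab : F * (F * F) | indep vab.2.1 vab.2.2].
have cardA : #|A| = (q ^ 3 * ((q ^ 3 - 1) * (q ^ 3 - q)))%N.
  have -> : A = setX setT [set ab in setX setT setT | indep ab.1 ab.2].
    by apply/setP=> -[v [a b]]; rewrite !inE.
  rewrite cardsX card_indep_pairs ?cardsT ?cardF ?inE //.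
  by move=> x a _ _; rewrite inE.
have fibre C : C \in cosets ->
    #|[set vab in A | coset vab.1 vab.2.1 vab.2.2 == C]|
      = (q ^ 2 * ((q ^ 2 - 1) * (q ^ 2 - q)))%N.
  case/imsetP=> -[v [a b]]; rewrite inE /= => ab ->.
  have -> : [set vab in A | coset vab.1 vab.2.1 vab.2.2 == coset v a b] =
     setX (coset v a b)
       [set ab in setX (coset 0 a b) (coset 0 a b) | indep ab.1 ab.2].
    apply/setP=> -[v' [a' b']]; rewrite !inE /= [RHS]andbA [RHS]andbC.
    by case ab': (indep a' b') => //=; rewrite coset_eqP.
  rewrite cardsX card_indep_pairs ?card_coset //.
    by apply/cosetP; exists 0, 0; rewrite fixed0; split=> //; ring.
  move=> x z xK /cosetP[s [t [sK tK ->]]]; apply/cosetP.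
  by exists (x * s), (x * t); rewrite !fixedM //; split=> //; ring.
have : #|A| = (#|cosets| * (q ^ 2 * ((q ^ 2 - 1) * (q ^ 2 - q))))%N.
  rewrite -sum1_card (partition_big_imset (fun vab => coset vab.1 vab.2.1 vab.2.2)) /=.
  rewrite (eq_bigr (fun=> (q ^ 2 * ((q ^ 2 - 1) * (q ^ 2 - q)))%N)).
    by rewrite sum_nat_const; congr (_ * _)%N.
  by move=> C CA; rewrite -(fibre C CA) -sum1dep_card; apply: eq_bigl => vab; rewrite inE.
rewrite cardA => e.
have pos : (0 < q ^ 2 * ((q ^ 2 - 1) * (q ^ 2 - q)))%N.
  have q0 : (0 < q)%N by exact: ltnW.
  have q2 : (q < q ^ 2)%N by rewrite -{1}[q]expn1 ltn_exp2l.
  by rewrite !muln_gt0 q0 !subn_gt0 q2 (leq_ltn_trans _ q2).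
apply/eqP; rewrite -(eqn_pmul2r pos) -e; apply/eqP.
(* With [q = n + 1] every difference becomes a polynomial in [n] with natural coefficients, so that
   [ring] can conclude without truncated subtraction. *)
case: (q) q_gt1 => // n _.
have E m k r : (k + r = m -> m - r = k)%N by move=> <-; rewrite addnK.
rewrite (E (n.+1 ^ 2) (n * (n + 2)) 1)%N; last by ring.
rewrite (E (n.+1 ^ 2) (n * n.+1) n.+1)%N; last by ring.
rewrite (E (n.+1 ^ 3) (n * (n ^ 2 + 3 * n + 3)) 1)%N; last by ring.
rewrite (E (n.+1 ^ 3) (n * n.+1 * (n + 2)) n.+1)%N; last by ring.
ring.
Qed.

(** * Rational matrices and the subspaces that they define *)

Hypothesis phiE : forall x, phi x = x ^+ q.

(** Invariance under [phi] is preferred to a condition on the entries because [map_mx] commutes with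
    products, inverses, kernels, cokernels and echelon bases. *)
Definition rational m n (A : 'M[F]_(m, n)) := map_mx phi A == A.

Lemma rationalP m n (A : 'M[F]_(m, n)) : reflect (forall i j, A i j \in K) (rational A).
Proof.
apply: (iffP eqP) => [h i j|h]; first by rewrite inE -{2}h mxE.
by apply/matrixP=> i j; rewrite mxE; apply/fixedP.
Qed.

Lemma rationalM m n p (A : 'M[F]_(m, n)) (B : 'M[F]_(n, p)) :
  rational A -> rational B -> rational (A *m B).
Proof. by rewrite /rational map_mxM => /eqP-> /eqP->. Qed.

Lemma rationalV n (A : 'M[F]_n) : rational A -> rational (invmx A).
Proof. by rewrite /rational map_invmx => /eqP->. Qed.

Lemma rational_row m n i (A : 'M[F]_(m, n)) : rational A -> rational (row i A).
Proof. by rewrite /rational map_row => /eqP->. Qed.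

Lemma rational_col m n j (A : 'M[F]_(m, n)) : rational A -> rational (col j A).
Proof. by rewrite /rational map_col => /eqP->. Qed.

Lemma rationalZ m n c (A : 'M[F]_(m, n)) : c \in K -> rational A -> rational (c *: A).
Proof.
by move=> cK /rationalP AK; apply/rationalP => i j; rewrite mxE fixedM.
Qed.

Lemma defined_overP (U : 'M[F]_3) :
  reflect (exists2 B : 'M[F]_3, rational B & U = <<B>>%MS) (defined_over q U).
Proof.
apply: (iffP existsP) => [[B /andP[BK /eqP ->]]|[B /rationalP BK ->]]; exists B => //.
  apply/rationalP=> i j; rewrite inE phiE.
  by move/forallP: BK => /(_ i)/forallP/(_ j).
rewrite eqxx andbT; apply/forallP=> i; apply/forallP=> j.
by rewrite -phiE; apply/eqP/fixedP.
Qed.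

Lemma eq_genmx_rV m1 m2 n (A : 'M[F]_(m1, n)) (B : 'M[F]_(m2, n)) :
  (forall u : 'rV_n, (u <= A)%MS = (u <= B)%MS) -> <<A>>%MS = <<B>>%MS.
Proof.
move=> AB; apply/genmxP/andP; split; apply/row_subP=> i.
  by rewrite -AB row_sub.
by rewrite AB row_sub.
Qed.

Lemma eq_genmx_rank m1 m2 n (A : 'M[F]_(m1, n)) (B : 'M[F]_(m2, n)) :
  (A <= B)%MS -> \rank A = \rank B -> <<A>>%MS = <<B>>%MS.
Proof.
by move=> AB rAB; apply/genmxP; have [_ <-] := mxrank_leqif_eq AB; rewrite rAB.
Qed.

Lemma exists_row_neq0 m n (A : 'M[F]_(m, n)) : A != 0 -> exists i, row i A != 0.
Proof.
move=> A0; apply/existsP; apply: contraNT A0; rewrite negb_exists => /forallP A0.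
apply/eqP/row_matrixP=> i; rewrite row0; apply/eqP.
by have := A0 i; rewrite negbK.
Qed.

Lemma exists_col_neq0 m n (A : 'M[F]_(m, n)) : A != 0 -> exists j, col j A != 0.
Proof.
rewrite -(inj_eq (@trmx_inj _ _ _)) trmx0 => /exists_row_neq0[j j0]; exists j.
by rewrite -(inj_eq (@trmx_inj _ _ _)) tr_col trmx0.
Qed.

Lemma pg_pointsP (P : 'M[F]_3) :
  reflect (exists2 u : 'rV_3, u != 0 & P = <<u>>%MS) (P \in pg_points F).
Proof.
rewrite inE; apply: (iffP andP) => [[/eqP PE /eqP rP]|[u u0 ->]]; last first.
  by rewrite genmx_id eqxx mxrank_gen rank_rV u0.
have [i i0] : exists i, row i P != 0.
  by apply: exists_row_neq0; rewrite -mxrank_eq0 rP.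
exists (row i P) => //; apply/esym; rewrite -[RHS]PE.
by apply: eq_genmx_rank; rewrite ?row_sub ?rank_rV ?i0 ?rP.
Qed.

(** * Points and lines of the image of PG(2, q) under an invertible matrix *)

Definition image_subplane g : subplane F :=
  (collineation g @: (PG2 F q).1, collineation g @: (PG2 F q).2).

Lemma image_pointP g P : g \in unitmx ->
  reflect (exists u : 'rV_3, [/\ rational u, u != 0 & P = <<u *m g>>%MS])
          (P \in (image_subplane g).1).
Proof.
move=> gU; apply: (iffP imsetP) => [[Q]|[u [uK u0 ->]]]; last first.
  exists <<u>>%MS.
    rewrite inE; apply/andP; split; first by apply/pg_pointsP; exists u.
    (* A square matrix is required: this one has three rows equal to [u]. *)
    apply/defined_overP; exists (const_mx 1 *m u).
      by apply: rationalM => //; rewrite /rational map_const_mx rmorph1.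
    apply/esym/eq_genmx/eqmxMfull; rewrite /row_full -mxrank_tr rank_rV trmx_const eqb1.
    by apply/eqP => /rowP/(_ 0)/eqP; rewrite !mxE oner_eq0.
  by rewrite /collineation; apply/eq_genmx/eqmxMr/eqmx_sym/genmxE.
rewrite !inE => /andP[/andP[_ rQ] /defined_overP[B BK QE]] ->.
have rB : \rank B = 1%N by rewrite -mxrank_gen -QE; apply/eqP.
have [i i0] : exists i, row i B != 0.
  by apply: exists_row_neq0; rewrite -mxrank_eq0 rB.
exists (row i B); split; rewrite ?rational_row // /collineation.
apply/eq_genmx/eqmxMr; rewrite QE; apply: eqmx_trans (genmxE _) _.
apply/eqmx_sym/eqmxP.
by have [_ <-] := mxrank_leqif_eq (row_sub i B); rewrite rank_rV i0 rB.
Qed.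

Lemma rank_kermx_cV n (c : 'cV[F]_n) : c != 0 -> \rank (kermx c) = n.-1.
Proof.
by move=> c0; rewrite mxrank_ker -mxrank_tr rank_rV trmx_eq0 c0 subn1.
Qed.

Lemma sub_kermx_mul g (n : 'cV[F]_3) (u : 'rV_3) : g \in unitmx ->
  (u <= kermx n *m g)%MS = (u <= kermx (invmx g *m n))%MS.
Proof.
move=> gU; rewrite -[u in LHS](mulmxKV gU) submxMfree ?row_free_unit //.
by rewrite !sub_kermx mulmxA.
Qed.

(** A line of PG(2, q) is the kernel of a rational column [n], and the collineation [g] turns this
    column into [invmx g *m n]. *)
Lemma image_lineP g m : g \in unitmx ->
  reflect (exists n : 'cV_3, [/\ rational n, n != 0 & m = <<kermx (invmx g *m n)>>%MS])
          (m \in (image_subplane g).2).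
Proof.
move=> gU; have kE (n : 'cV_3) : <<kermx (invmx g *m n)>>%MS = collineation g (kermx n).
  by rewrite /collineation; apply: eq_genmx_rV => u; rewrite (sub_kermx_mul n u gU).
apply: (iffP imsetP) => [[Q]|[n [nK n0 ->]]]; last first.
  exists <<kermx n>>%MS.
    rewrite !inE genmx_id eqxx mxrank_gen rank_kermx_cV //=.
    apply/defined_overP; exists (kermx n) => //.
    by rewrite /rational map_kermx (eqP nK).
  by rewrite kE; apply/eq_genmx/eqmxMr/eqmx_sym/genmxE.
rewrite !inE => /andP[/andP[_ rQ] /defined_overP[B BK QE]] ->.
have rB : \rank B = 2 by rewrite -mxrank_gen -QE; apply/eqP.
(* A nonzero column of the cokernel of [B] annihilates its row space; it is rational because [B] is,
   and its kernel has rank 2 as well. *)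
have [j j0] : exists j, col j (cokermx B) != 0.
  by apply: exists_col_neq0; rewrite -mxrank_eq0 mxrank_coker rB.
exists (col j (cokermx B)); split=> //.
  by apply: rational_col; rewrite /rational map_cokermx (eqP BK).
rewrite kE; apply/eq_genmx/eqmxMr; rewrite QE; apply: eqmx_trans (genmxE _) _.
have sB : (B <= kermx (col j (cokermx B)))%MS.
  by rewrite sub_kermx colE mulmxA mulmx_coker mul0mx.
by apply/eqmxP; have [_ <-] := mxrank_leqif_eq sB; rewrite rank_kermx_cV ?rB.
Qed.

Lemma invmx_mulmx n (A B : 'M[F]_n.+1) : A \in unitmx -> B \in unitmx ->
  invmx (A *m B) = invmx B *m invmx A.
Proof. exact: invrM. Qed.

(** A rational invertible [k] stabilises PG(2, q) and scalars act trivially. This is the freedom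
    used to normalise the matrix of a subplane. *)
Lemma image_subplane_scale c k g : c != 0 -> rational k -> k \in unitmx ->
  g \in unitmx -> image_subplane (c *: (k *m g)) = image_subplane g.
Proof.
move=> c0 kK kU gU.
have kgU : k *m g \in unitmx by rewrite unitmx_mul kU.
have cgU : c *: (k *m g) \in unitmx by rewrite unitmxZ ?unitfE.
have pointE (u : 'rV_3) : <<u *m (c *: (k *m g))>>%MS = <<u *m k *m g>>%MS.
  by rewrite -scalemxAr mulmxA; apply: eq_genmx; apply: eqmx_scale.
have lineE (n : 'cV_3) : <<kermx (invmx (c *: (k *m g)) *m n)>>%MS
                       = <<kermx (invmx g *m (invmx k *m n))>>%MS.
  apply: eq_genmx_rV => u; rewrite !sub_kermx invmxZ // invmx_mulmx //.
  by rewrite -scalemxAl -scalemxAr scaler_eq0 invr_eq0 (negPf c0) /= !mulmxA.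
rewrite [LHS]surjective_pairing [RHS]surjective_pairing; congr pair.
  apply/setP=> P; apply/image_pointP/image_pointP=> // -[u [uK u0 ->]].
    exists (u *m k); rewrite pointE; split=> //; first exact: rationalM.
    by apply: contraNneq u0 => /(canRL (mulmxK kU))->; rewrite mul0mx.
  exists (u *m invmx k); rewrite pointE mulmxKV //; split=> //.
    exact: rationalM (rationalV _).
  by apply: contraNneq u0 => /(canRL (mulmxKV kU))->; rewrite mul0mx.
apply/setP=> P; apply/image_lineP/image_lineP=> // -[n [nK n0 ->]].
  exists (invmx k *m n); rewrite lineE; split=> //.
    by apply: rationalM => //; apply: rationalV.
  by apply: contraNneq n0 => /(canRL (mulKVmx kU))->; rewrite mulmx0.
exists (k *m n); rewrite lineE mulKmx //; split=> //; first exact: rationalM.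
by apply: contraNneq n0 => /(canRL (mulKmx kU))->; rewrite mulmx0.
Qed.

Lemma unitmx_rV n (A : 'M[F]_n) : (forall u : 'rV_n, u *m A = 0 -> u = 0) -> A \in unitmx.
Proof.
move=> A0; rewrite -row_free_unit -kermx_eq0; apply/rowV0P=> u.
by rewrite sub_kermx => /eqP/A0.
Qed.

(** The kernel of a rational matrix is spanned by rational vectors, as [kermx] commutes with [phi],
    so rational columns suffice to detect singularity. *)
Lemma rational_unitmx n (k : 'M[F]_n) : rational k ->
  (forall u : 'cV_n, rational u -> k *m u = 0 -> u = 0) -> k \in unitmx.
Proof.
move=> kK k0; rewrite -unitmx_tr -row_free_unit -kermx_eq0.
apply/eqP/row_matrixP=> i; rewrite row0; apply: trmx_inj; rewrite trmx0; apply: k0.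
  rewrite /rational -map_trmx map_row map_kermx -map_trmx.
  by rewrite (eqP kK).
by apply: trmx_inj; rewrite trmx_mul trmxK trmx0 -row_mul mulmx_ker row0.
Qed.

Lemma genmx_rV_eq n (u w : 'rV[F]_n) : u != 0 -> <<u>>%MS = <<w>>%MS ->
  exists2 c, c != 0 & u = c *: w.
Proof.
move=> u0 /genmxP/andP[/sub_rVP[c uE] _]; exists c => //.
by apply: contraNneq u0 => c0; rewrite uE c0 scale0r.
Qed.

(** * Explicit coordinates and normal matrices *)

Definition vec3 (x y z : F) : 'rV[F]_3 := \row_i [:: x; y; z]`_i.

Lemma vec3E (u : 'rV[F]_3) : u = vec3 (u 0 0) (u 0 1) (u 0 2).
Proof.
apply/rowP=> -[[|[|[|//]]] i]; rewrite !mxE /=; congr (u _ _); exact: val_inj.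
Qed.

Lemma vec3_inj x y z x' y' z' : vec3 x y z = vec3 x' y' z' -> [/\ x = x', y = y' & z = z'].
Proof.
by move=> e; split; [move/rowP/(_ 0): e|move/rowP/(_ 1): e|move/rowP/(_ 2): e]; rewrite !mxE.
Qed.

Lemma vec3_0 : vec3 0 0 0 = 0.
Proof. by apply/rowP=> -[[|[|[|//]]] i]; rewrite !mxE. Qed.

Lemma vec3Z c x y z : c *: vec3 x y z = vec3 (c * x) (c * y) (c * z).
Proof. by apply/rowP=> -[[|[|[|//]]] i]; rewrite !mxE. Qed.

Lemma vec3D x y z x' y' z' : vec3 x y z + vec3 x' y' z' = vec3 (x + x') (y + y') (z + z').
Proof. by apply/rowP=> -[[|[|[|//]]] i]; rewrite !mxE. Qed.

Lemma vec3_dot x y z x' y' z' : vec3 x y z *m (vec3 x' y' z')^T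
  = (x * x' + y * y' + z * z')%:M.
Proof.
apply/matrixP=> i j; rewrite !ord1 !mxE !big_ord_recl big_ord0 !mxE /= mulr1n; ring.
Qed.

Lemma vec3_dot_eq0 x y z x' y' z' :
  (vec3 x y z *m (vec3 x' y' z')^T == 0) = (x * x' + y * y' + z * z' == 0).
Proof.
rewrite vec3_dot; apply/eqP/eqP => [/matrixP/(_ 0 0)|->]; last exact: raddf0.
by rewrite !mxE mulr1n.
Qed.

Lemma vec3_colE (n : 'cV[F]_3) : n = (vec3 (n 0 0) (n 1 0) (n 2 0))^T.
Proof. by rewrite -[LHS]trmxK [n^T]vec3E !mxE. Qed.

Lemma rational_vec3 x y z : rational (vec3 x y z) = [&& x \in K, y \in K & z \in K].
Proof.
apply/rationalP/and3P=> [h|[xK yK zK] i [[|[|[|//]]] j]]; try by rewrite mxE.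
by split; [move: (h 0 0)|move: (h 0 1)|move: (h 0 2)]; rewrite mxE.
Qed.

Lemma rational_tr m n (A : 'M[F]_(m, n)) : rational A^T = rational A.
Proof.
by apply/rationalP/rationalP => h i j; move: (h j i); rewrite mxE.
Qed.

Definition normal_mx v a b t r s : 'M[F]_3 :=
  \matrix_i [:: vec3 1 0 0; vec3 v a b; vec3 t r s]`_i.

Lemma normal_mx_col v a b t r s x y z : normal_mx v a b t r s *m (vec3 x y z)^T
  = (vec3 x (v * x + a * y + b * z) (t * x + r * y + s * z))^T.
Proof.
apply/matrixP=> -[[|[|[|//]]] i] j; rewrite !mxE !big_ord_recl big_ord0 !mxE /= ?mxE /=; ring.
Qed.

Lemma normal_mx_row v a b t r s x y z : vec3 x y z *m normal_mx v a b t r s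
  = vec3 (x + y * v + z * t) (y * a + z * r) (y * b + z * s).
Proof.
apply/rowP=> -[[|[|[|//]]] i]; rewrite !mxE !big_ord_recl big_ord0 !mxE /= ?mxE /=; ring.
Qed.

Lemma indep_neq0 a b : indep a b -> a != 0.
Proof. by apply: contraNneq => ->; rewrite /indep invr0 mulr0 fixed0. Qed.

Lemma normal_mx_unit v a b t r s : indep a b ->
  (normal_mx v a b t r s \in unitmx) = (a * s != b * r).
Proof.
move=> /indep_neq0 a0; apply/idP/idP=> [NU|ne].
  apply: contraNneq a0 => e.
  (* These are the cofactors of the last column: their product with the matrix is [(0, 0, det)], and
     the determinant [a * s - b * r] vanishes here. *)
  have : vec3 (r * v - a * t) (- r) a *m normal_mx v a b t r s = 0.
    by rewrite normal_mx_row -vec3_0; congr vec3; try ring; rewrite e; ring.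
  by move/(canRL (mulmxK NU)); rewrite mul0mx -vec3_0 => /vec3_inj[_ _ <-].
apply: unitmx_rV => u; rewrite [u]vec3E normal_mx_row -vec3_0 => /vec3_inj[].
move: (u 0 0) (u 0 1) (u 0 2) => x y z e0 e1 e2.
have z0 : z = 0.
  have /eqP : z * (a * s - b * r) = 0.
    transitivity (a * (y * b + z * s) - b * (y * a + z * r)); first by ring.
    by rewrite e1 e2; ring.
  by rewrite mulf_eq0 subr_eq0 (negPf ne) orbF => /eqP.
have y0 : y = 0.
  by move/eqP: e1; rewrite z0 mul0r addr0 mulf_eq0 (negPf a0) orbF => /eqP.
by move: e0; rewrite y0 z0 !mul0r !addr0 => ->.
Qed.

(* Coordinates adapted to the flag made of [l] and the point [frame_point M] on it. *)
Definition frame (M l : 'M[F]_3) :=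
  M \in unitmx /\ forall u : 'rV_3, (u *m M <= l)%MS = (u 0 2 == 0).

Definition frame_point (M : 'M[F]_3) : 'M[F]_3 := <<vec3 1 0 0 *m M>>%MS.
(** With this sign the line of column [(x, y, t)] passes through the point exactly when [y = z * x];
    splashes thus become cosets rather than their opposites. *)
Definition affine_point (M : 'M[F]_3) (z : F) : 'M[F]_3 := <<vec3 (- z) 1 0 *m M>>%MS.

Lemma vec3_100_neq0 : vec3 1 0 0 != 0.
Proof. by rewrite -vec3_0; apply/eqP => /vec3_inj[/eqP]; rewrite oner_eq0. Qed.

Lemma vec3_x10_neq0 x : vec3 x 1 0 != 0.
Proof. by rewrite -vec3_0; apply/eqP => /vec3_inj[_ /eqP]; rewrite oner_eq0. Qed.

Lemma mulmx_unit_neq0 (M : 'M[F]_3) (u : 'rV_3) : M \in unitmx -> (u *m M != 0) = (u != 0).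
Proof. by move=> MU; rewrite mulmx_free_eq0 ?row_free_unit. Qed.

Lemma genmx_mul_eq M (u w : 'rV[F]_3) : M \in unitmx -> u != 0 ->
  <<u *m M>>%MS = <<w *m M>>%MS -> exists2 c, c != 0 & u = c *: w.
Proof.
move=> MU u0 /genmx_rV_eq[|c c0 e]; first by rewrite mulmx_unit_neq0.
exists c => //; move/(canRL (mulmxK MU)): e => ->.
by rewrite -scalemxAl mulmxK.
Qed.

Lemma frame_point_neq M z : M \in unitmx -> frame_point M <> affine_point M z.
Proof.
move=> MU /genmx_mul_eq[||c c0] //; first exact: vec3_100_neq0.
by rewrite vec3Z => /vec3_inj[_ /esym/eqP]; rewrite mulr1 (negPf c0).
Qed.

Lemma affine_point_inj M : M \in unitmx -> injective (affine_point M).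
Proof.
move=> MU z z' /genmx_mul_eq[||c c0] //; first exact: vec3_x10_neq0.
by rewrite vec3Z => /vec3_inj[e1 e2 _]; apply: oppr_inj; rewrite e1 -[c]mulr1 -e2 mul1r.
Qed.

Lemma frame_pg_points M (u : 'rV[F]_3) : M \in unitmx -> u != 0 ->
  <<u *m M>>%MS \in pg_points F.
Proof. by move=> MU u0; apply/pg_pointsP; exists (u *m M); rewrite ?mulmx_unit_neq0. Qed.

Lemma frame_pointsP M l P : frame M l ->
  reflect (P = frame_point M \/ exists z, P = affine_point M z)
          ((P \in pg_points F) && (P <= l)%MS).
Proof.
move=> [MU Ml]; apply: (iffP andP) => [[/pg_pointsP[u u0 ->]]|[|[z]] ->].
- rewrite genmxE -[u](mulmxKV MU) Ml.
  have : u *m invmx M != 0 by rewrite mulmx_unit_neq0 ?unitmx_inv.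
  move: (u *m invmx M) => {u0}u; rewrite [u]vec3E; move: (u 0 0) (u 0 1) (u 0 2).
  move=> x y z u0; rewrite mxE /= => /eqP z0; rewrite {}z0 in u0 *.
  have [y0|y0] := eqVneq y 0; [left|right; exists (- (x / y))].
    rewrite y0 in u0 *; have x0 : x != 0 by apply: contraNneq u0 => ->; rewrite vec3_0.
    rewrite -[vec3 x 0 0](_ : x *: vec3 1 0 0 = _); last by rewrite vec3Z mulr1 mulr0.
    by rewrite /frame_point -scalemxAl; apply/eq_genmx/eqmx_scale.
  rewrite -[vec3 x y 0](_ : y *: vec3 (x / y) 1 0 = _).
    by rewrite /affine_point opprK -scalemxAl; apply/eq_genmx/eqmx_scale.
  by rewrite vec3Z mulr1 mulr0 mulrC divfK.
- by rewrite genmxE Ml mxE frame_pg_points ?vec3_100_neq0.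
- by rewrite genmxE Ml mxE frame_pg_points ?vec3_x10_neq0.
Qed.

(** * Centre and splash of a subplane in normal form *)

Definition normal_subplane M v a b t r s :=
  image_subplane (invmx (normal_mx v a b t r s) *m M).

(** Taking the image under [invmx h *m M] makes the lines of the subplane, in the coordinates of
    [M], the columns [h *m n] with [n] rational. *)
Lemma splashP M l h (w : 'rV[F]_3) : frame M l -> h \in unitmx -> w != 0 -> w 0 2 = 0 ->
  reflect (exists n : 'cV_3, [/\ rational n, n != 0 & w *m h *m n = 0])
          (<<w *m M>>%MS \in splash l (image_subplane (invmx h *m M))).
Proof.
move=> [MU Ml] hU w0 w2.
have gU : invmx h *m M \in unitmx by rewrite unitmx_mul unitmx_inv hU.
rewrite inE frame_pg_points // genmxE Ml w2 eqxx /=.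
have incE (n : 'cV_3) :
    (<<w *m M>> <= <<kermx (invmx (invmx h *m M) *m n)>>)%MS = (w *m h *m n == 0).
  by rewrite !genmxE sub_kermx invmx_mulmx ?unitmx_inv // invmxK !mulmxA mulmxK.
apply: (iffP existsP) => [[m /andP[/image_lineP-/(_ gU)[n [nK n0 ->]]]]|[n [nK n0 wn]]].
  by rewrite incE => /eqP wn; exists n.
exists <<kermx (invmx (invmx h *m M) *m n)>>%MS; rewrite incE wn eqxx andbT.
by apply/image_lineP => //; exists n.
Qed.

(** Dually to the lines, the points of the subplane are represented in the coordinates of [M] by
    rows [w] such that [w *m h] is rational. *)
Lemma meet_imageP M l h P : frame M l -> h \in unitmx ->
  reflect (exists w : 'rV_3, [/\ rational (w *m h), w != 0, w 0 2 = 0 & P = <<w *m M>>%MS])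
          (P \in meet l (image_subplane (invmx h *m M))).
Proof.
move=> [MU Ml] hU.
have gU : invmx h *m M \in unitmx by rewrite unitmx_mul unitmx_inv hU.
rewrite inE; apply: (iffP andP) => [[/image_pointP-/(_ gU)[u [uK u0 ->]]]|[w [wK w0 w2 ->]]].
  rewrite mulmxA genmxE Ml => /eqP u2; exists (u *m invmx h); rewrite mulmxKV //.
  by split=> //; rewrite mulmx_unit_neq0 ?unitmx_inv.
rewrite genmxE Ml w2 eqxx; split=> //; apply/image_pointP => //.
by exists (w *m h); rewrite mulmx_unit_neq0 // mulmxA mulmxK.
Qed.

Section NormalSubplane.

Variables (M l : 'M[F]_3) (v a b t r s : F).
Hypotheses (Ml : frame M l) (ab : indep a b).
Hypothesis NU : normal_mx v a b t r s \in unitmx.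

Lemma meet_normal_subplane :
  meet l (normal_subplane M v a b t r s) = [set frame_point M].
Proof.
apply/setP=> P; rewrite /normal_subplane [RHS]in_set1.
apply/(meet_imageP _ Ml NU)/eqP => [[w]|->]; last first.
  exists (vec3 1 0 0); split=> //; rewrite ?vec3_100_neq0 ?mxE //.
  by rewrite normal_mx_row rational_vec3 !mul0r !addr0 fixed0 fixed1.
rewrite [w]vec3E; move: (w 0 0) (w 0 1) (w 0 2) => x y z [].
rewrite mxE /= => + + z0; rewrite {}z0 normal_mx_row rational_vec3 !mul0r !addr0.
move=> /and3P[_ yaK ybK] w0 ->.
have ya0 : y * a = 0.
  (* Both [y * a] and [y * b] lie in [K], so this identity is a linear relation over [K] between [a]
     and [b]. *)
  have e : - (y * b) * a + y * a * b = 0 by ring.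
  by have [] := indep_eq0 ab (fixedN ybK) yaK e.
have y0 : y = 0.
  by move/eqP: ya0; rewrite mulf_eq0 (negPf (indep_neq0 ab)) orbF => /eqP.
rewrite y0 in w0 *; have x0 : x != 0.
  by apply: contraNneq w0 => ->; rewrite vec3_0.
rewrite /frame_point -[vec3 x 0 0](_ : x *: vec3 1 0 0 = _).
  by rewrite -scalemxAl; apply/eq_genmx/eqmx_scale.
by rewrite vec3Z mulr1 !mulr0.
Qed.

Lemma normal_subplane_tangent :
  normal_subplane M v a b t r s \in tangent_subplanes q l.
Proof.
rewrite inE meet_normal_subplane cards1 eqxx andbT; apply/imsetP.
by exists (invmx (normal_mx v a b t r s) *m M); rewrite // unitmx_mul unitmx_inv NU; case: Ml.
Qed.

Lemma splash_normal_subplane : splash l (normal_subplane M v a b t r s)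
  = frame_point M |: affine_point M @: coset v a b.
Proof.
apply/setP=> P; rewrite /normal_subplane [RHS]in_setU1.
have [Pl|nPl] := boolP ((P \in pg_points F) && (P <= l)%MS); last first.
  rewrite inE andbA (negPf nPl) /=; apply/esym; apply: contraNF nPl.
  case/orP=> [/eqP->|/imsetP[z _ ->]]; apply/(frame_pointsP _ Ml); first by left.
  by right; exists z.
case/(frame_pointsP _ Ml): (Pl) => [->|[z ->]].
  rewrite eqxx /=; apply/(splashP Ml NU); rewrite ?vec3_100_neq0 ?mxE //.
  (* The corresponding line has column [(0, a, r)], and its first entry 0 puts the centre on it. *)
  exists (vec3 0 1 0)^T; rewrite rational_tr rational_vec3 fixed0 fixed1 /=.
  split=> //; first by rewrite trmx_eq0 vec3_x10_neq0.
  by apply/eqP; rewrite -mulmxA normal_mx_col vec3_dot_eq0; apply/eqP; ring.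
have -> : (affine_point M z == frame_point M) = false.
  by apply/eqP => /esym; apply: frame_point_neq; case: Ml.
have zE (n : 'cV_3) : (vec3 (- z) 1 0 *m normal_mx v a b t r s *m n == 0)
   = (z * n 0 0 == v * n 0 0 + (n 1 0 * a + n 2 0 * b)).
  rewrite {1}[n]vec3_colE -mulmxA normal_mx_col vec3_dot_eq0 -[RHS]subr_eq0 -[RHS]oppr_eq0.
  by congr (_ == 0); ring.
apply/(splashP Ml NU)/imsetP; rewrite ?vec3_x10_neq0 ?mxE //.
  case=> n [nK n0 /eqP]; rewrite zE => /eqP e.
  move/rationalP in nK.
  (* If [n 0 0] vanished, incidence would give a relation between [a] and [b]. Dividing [n] by this
     entry then produces the coefficients in [K]. *)
  have n00 : n 0 0 != 0.
    apply: contraNneq n0 => n00; move/eqP: e; rewrite n00 !mulr0 add0r eq_sym => /eqP e.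
    have [n1 n2] := indep_eq0 ab (nK 1 0) (nK 2 0) e.
    by rewrite -trmx_eq0 [n^T]vec3E !mxE n00 n1 n2 vec3_0.
  exists z => //; apply/cosetP; exists (n 1 0 / n 0 0), (n 2 0 / n 0 0).
  by rewrite !fixed_div //; split=> //; apply: (mulIf n00); rewrite e; field.
case=> z' /cosetP[x [y [xK yK ->]]] /(affine_point_inj (proj1 Ml)) ez.
exists (vec3 1 x y)^T; rewrite rational_tr rational_vec3 fixed1 xK yK; split=> //.
  by rewrite trmx_eq0 -vec3_0; apply/eqP=> /vec3_inj[/eqP]; rewrite oner_eq0.
by apply/eqP; rewrite zE !mxE /= ez; apply/eqP; ring.
Qed.
End NormalSubplane.

(** The transposes of both columns lie in the annihilator of the common kernel, which has dimension
    1. *)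
Lemma kermx_cV_inj n (c c' : 'cV[F]_n.+1) : c' != 0 ->
  <<kermx c>>%MS = <<kermx c'>>%MS -> exists k, c = k *: c'.
Proof.
move=> c0 /genmxP/andP[_]; rewrite sub_kermx => /eqP e.
have sc : (c'^T <= kermx (kermx c')^T)%MS.
  by rewrite sub_kermx -trmx_mul mulmx_ker trmx0.
have : (c^T <= kermx (kermx c')^T)%MS by rewrite sub_kermx -trmx_mul e trmx0.
have [_ /esym] := mxrank_leqif_sup sc.
rewrite rank_rV trmx_eq0 c0 mxrank_ker mxrank_tr rank_kermx_cV // subSnn eqxx.
move=> sk /submx_trans/(_ sk)/sub_rVP[k /(congr1 trmx)]; rewrite trmxK linearZ /= trmxK => ->.
by exists k.
Qed.

(** The line of the first subplane with column [(1, v + a * x + b * y, t + r * x + s * y)] must be a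
    line of the second. Its first two entries already determine the rational vector there, so the
    third entries agree for all [x], [y] in [K]. *)
Lemma normal_subplane_inj M v a b t r s t' r' s' : M \in unitmx -> indep a b ->
  normal_mx v a b t r s \in unitmx -> normal_mx v a b t' r' s' \in unitmx ->
  normal_subplane M v a b t r s = normal_subplane M v a b t' r' s' ->
  [/\ t = t', r = r' & s = s'].
Proof.
move=> MU ab NU NU' e.
have gU : invmx (normal_mx v a b t r s) *m M \in unitmx by rewrite unitmx_mul unitmx_inv NU.
have gU' : invmx (normal_mx v a b t' r' s') *m M \in unitmx by rewrite unitmx_mul unitmx_inv NU'.
have key x y : x \in K -> y \in K -> t + r * x + s * y = t' + r' * x + s' * y.
  move=> xK yK.
  have : <<kermx (invmx (invmx (normal_mx v a b t r s) *m M) *m (vec3 1 x y)^T)>>%MS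
         \in (normal_subplane M v a b t' r' s').2.
    rewrite -e; apply/image_lineP => //; exists (vec3 1 x y)^T; split=> //.
      by rewrite rational_tr rational_vec3 fixed1 xK yK.
    by rewrite trmx_eq0 -vec3_0; apply/eqP=> /vec3_inj[/eqP]; rewrite oner_eq0.
  case/(image_lineP _ gU') => n [nK n0] /kermx_cV_inj[|k].
    by apply: contraNneq n0 => /(canRL (mulKVmx gU'))->; rewrite mulmx0.
  rewrite !invmx_mulmx ?unitmx_inv // !invmxK -!mulmxA scalemxAr.
  move/(can_inj (mulKVmx MU)); rewrite [n]vec3_colE !normal_mx_col -linearZ /= vec3Z.
  move/trmx_inj/vec3_inj.
  move/rationalP: nK => nK; move: (nK 0 0) (nK 1 0) (nK 2 0).
  move: (n 0 0) (n 1 0) (n 2 0) => x0 x1 x2 x0K x1K x2K [kx0 e1 e2].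
  (* The first row of a normal matrix is [(1, 0, 0)], so comparing first entries gives [1 = k * x0]
     with [x0] in [K]. *)
  have kK : k \in K.
    have x00 : x0 != 0 by apply/eqP => x00; move/eqP: kx0; rewrite x00 mulr0 oner_eq0.
    by rewrite -[k](mulfK x00) -kx0 fixed_div ?fixed1.
  have [] := @indep_eq0 a b (x - k * x1) (y - k * x2) ab.
  - by rewrite fixedB ?fixedM.
  - by rewrite fixedB ?fixedM.
  - transitivity (v * 1 + a * x + b * y - (v * 1 + k * (a * x1 + b * x2))); first by ring.
    by rewrite e1 kx0; ring.
  move/eqP; rewrite subr_eq0 => /eqP ex /eqP; rewrite subr_eq0 => /eqP ey.
  rewrite mulr1 in e2; rewrite e2 ex ey -[in RHS](mulr1 t') kx0; ring.
have et : t = t' by have := key 0 0 fixed0 fixed0; rewrite !mulr0 !addr0.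
split=> //.
  by have := key 1 0 fixed1 fixed0; rewrite et !mulr0 !addr0 !mulr1 => /addrI.
by have := key 0 1 fixed0 fixed1; rewrite et !mulr0 !addr0 !mulr1 => /addrI.
Qed.

Lemma image_subplane_mulr (M h k : 'M[F]_3) : M \in unitmx -> h \in unitmx ->
  rational k -> k \in unitmx ->
  image_subplane (invmx (h *m k) *m M) = image_subplane (invmx h *m M).
Proof.
move=> MU hU kK kU; rewrite invmx_mulmx // -mulmxA -[invmx k *m _]scale1r.
by rewrite image_subplane_scale ?oner_eq0 ?rationalV ?unitmx_inv ?unitmx_mul ?unitmx_inv ?hU.
Qed.

(** * Reduction of a tangent subplane to normal form *)

Section TangentSubplane.

Variables (M l : 'M[F]_3) (pi : subplane F).
Hypotheses (Ml : frame M l) (pi_tangent : pi \in tangent_subplanes q l).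
Hypothesis pi_meet : meet l pi = [set frame_point M].

(* The centre being a point of [pi], the matrix can be scaled to make its first
   row rational. *)
Lemma tangent_rational_row : exists h : 'M[F]_3,
  [/\ h \in unitmx, rational (vec3 1 0 0 *m h) & pi = image_subplane (invmx h *m M)].
Proof.
have [MU _] := Ml.
case/setIdP: pi_tangent => /imsetP[g gU piE] _.
have {}gU : g \in unitmx by [].
have : frame_point M \in meet l pi by rewrite pi_meet set11.
rewrite piE inE => /andP[/(image_pointP _ gU)[u [uK u0 Tu]] _].
have [|c c0 uE] := genmx_rV_eq _ (esym Tu); first by rewrite mulmx_unit_neq0.
have hU : M *m invmx g \in unitmx by rewrite unitmx_mul MU unitmx_inv.
exists (c *: (M *m invmx g)); split.
- by rewrite unitmxZ ?unitfE.
- by rewrite -scalemxAr mulmxA scalemxAl -uE mulmxK.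
rewrite invmxZ ?unitmxZ ?unitfE // invmx_mulmx ?unitmx_inv // invmxK -scalemxAl mulmxKV //.
rewrite -[g in RHS]mul1mx image_subplane_scale ?invr_eq0 ?unitmx1 //.
by rewrite /rational map_mx1.
Qed.

(** A nonzero such [n] would make [l] itself a line of [pi]. Every rational point in the kernel of
    [n] would then lie on [l], hence be the centre, although that kernel has rank 2. *)
Lemma tangent_no_secant h (n : 'cV[F]_3) : h \in unitmx ->
  pi = image_subplane (invmx h *m M) -> rational n ->
  (h *m n) 0 0 = 0 -> (h *m n) 1 0 = 0 -> n = 0.
Proof.
(* The true fact [2 <= 2] merely sets up the contraposition; the contradiction is the rank
   inequality [2 <= 1] reached from the inclusion below. *)
move=> hU piE nK hn0 hn1; apply: contraTeq (leqnn 2) => n0.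
have hn2 : (h *m n) 2 0 != 0.
  apply: contraNneq n0 => hn2; have : h *m n = 0.
    by rewrite [LHS]vec3_colE hn0 hn1 hn2 vec3_0 trmx0.
  by move/(canRL (mulKmx hU))->; rewrite mulmx0.
suff : (kermx n <= vec3 1 0 0 *m h)%MS.
  by move/mxrankS; rewrite rank_kermx_cV // => /leq_trans/(_ (rank_leq_row _)).
apply/row_subP=> i; set u := row i _.
have [->|u0] := eqVneq u 0; first exact: sub0mx.
have uK : rational u by apply: rational_row; rewrite /rational map_kermx (eqP nK).
have un : u *m n = 0 by rewrite -row_mul mulmx_ker row0.
have : <<u *m invmx h *m M>>%MS \in meet l pi.
  rewrite piE; apply/(meet_imageP _ Ml hU); exists (u *m invmx h).
  rewrite mulmxKV // mulmx_unit_neq0 ?unitmx_inv //; split=> //.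
  have /eqP := un; rewrite -[u in u *m n](mulmxKV hU) -(mulmxA (u *m invmx h)).
  rewrite [h *m n]vec3_colE hn0 hn1 {1}[u *m invmx h]vec3E vec3_dot_eq0 !mulr0 !add0r.
  by rewrite mulf_eq0 (negPf hn2) orbF => /eqP.
rewrite pi_meet inE => /eqP/genmx_mul_eq[||c _ uE]; first by case: Ml.
  by rewrite mulmx_unit_neq0 ?unitmx_inv.
by apply/sub_rVP; exists c; rewrite scalemxAl -uE mulmxKV.
Qed.

(** Elimination on the rational first row yields a rational [k] that brings it to [(1, 0, 0)]. A
    relation [x * a + y * b = 0] over [K] would give the column [(0, x, y)] two vanishing entries
    after [h'], which [tangent_no_secant] excludes. *)
Lemma tangent_normal_form : exists v a b t r s,
  [/\ indep a b, normal_mx v a b t r s \in unitmx & pi = normal_subplane M v a b t r s].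
Proof.
have [MU _] := Ml; have [h [hU PK piE]] := tangent_rational_row.
set P := vec3 1 0 0 *m h in PK.
have rP : \rank P = 1%N by rewrite rank_rV mulmx_unit_neq0 // vec3_100_neq0.
pose U := row_ebase P; have UU : U \in unitmx by exact: row_ebase_unit.
have UK : rational U by rewrite /rational map_row_ebase (eqP PK).
(* As [P] is a single row of rank 1, its echelon factorisation reads [P = c *: vec3 1 0 0 *m U]. *)
pose c := col_ebase P 0 0.
have cK : c \in K.
  have : rational (col_ebase P) by rewrite /rational map_col_ebase (eqP PK).
  by move/rationalP; apply.
have PE : P *m invmx U = c *: vec3 1 0 0.
  rewrite -{1}(mulmx_ebase P) mulmxK // rP [col_ebase P]mx11_scalar mul_scalar_mx.
  by congr (_ *: _); apply/rowP=> -[[|[|[|//]]] i]; rewrite !mxE.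
have c0 : c != 0.
  apply/eqP => c0; have /eqP := PE; rewrite c0 scale0r.
  by rewrite -mxrank_eq0 mxrankMfree ?row_free_unit ?unitmx_inv // rP.
pose k := c^-1 *: invmx U.
have kK : rational k by rewrite rationalZ ?fixedV ?rationalV.
have kU : k \in unitmx by rewrite unitmxZ ?unitfE ?invr_eq0 ?unitmx_inv.
have Pk : vec3 1 0 0 *m (h *m k) = vec3 1 0 0.
  by rewrite mulmxA -scalemxAr PE scalerA mulVf // scale1r.
set h' := h *m k in Pk; have h'U : h' \in unitmx by rewrite unitmx_mul hU.
have piE' : pi = image_subplane (invmx h' *m M) by rewrite image_subplane_mulr.
clearbody h'.
have h'E : h' = normal_mx (h' 1 0) (h' 1 1) (h' 1 2) (h' 2 0) (h' 2 1) (h' 2 2).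
  apply/row_matrixP=> -[[|[|[|//]]] i].
  - by rewrite rowK /= -Pk rowE; congr (_ *m _); apply/rowP=> -[[|[|[|//]]] j]; rewrite !mxE.
  - by rewrite rowK /= [LHS]vec3E !mxE; congr vec3; congr (h' _ _); apply: val_inj.
  - by rewrite rowK /= [LHS]vec3E !mxE; congr vec3; congr (h' _ _); apply: val_inj.
exists (h' 1 0), (h' 1 1), (h' 1 2), (h' 2 0), (h' 2 1), (h' 2 2).
rewrite /normal_subplane -h'E; split=> //.
apply: indepNP => x y xK yK e.
have : (vec3 0 x y)^T = 0.
  apply: (tangent_no_secant h'U piE'); rewrite ?rational_tr ?rational_vec3 ?fixed0 ?xK ?yK //.
    by rewrite h'E normal_mx_col !mxE.
  by rewrite h'E normal_mx_col !mxE /= mulr0 add0r ![h' 1 _ * _]mulrC.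
by move/(congr1 trmx); rewrite trmxK trmx0 -vec3_0 => /vec3_inj[].
Qed.

(** A line through the splash point has column [(m, z * m, _)]. Here [m] is in [K], being the
    product of the rational first row with [n], and is nonzero by [tangent_no_secant]; so [n] can be
    divided by it. *)
Lemma tangent_ray h z : h \in unitmx -> rational (vec3 1 0 0 *m h) ->
  pi = image_subplane (invmx h *m M) -> affine_point M z \in splash l pi ->
  exists2 n : 'cV[F]_3, rational n & exists t, h *m n = (vec3 1 z t)^T.
Proof.
move=> hU hK piE; have w2 : vec3 (- z) 1 0 0 2 = 0 by rewrite mxE.
rewrite {1}piE => /(splashP Ml hU (vec3_x10_neq0 _) w2)[n [nK n0 e]].
have e1 : (h *m n) 1 0 = z * (h *m n) 0 0.
  have /eqP := e; rewrite -mulmxA {1}[h *m n]vec3_colE vec3_dot_eq0 mul0r addr0 mul1r.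
  by rewrite mulNr addrC subr_eq0 => /eqP.
set m := (h *m n) 0 0 in e1.
have mK : m \in K.
  have /rationalP/(_ 0 0) := rationalM hK nK.
  rewrite -mulmxA {1}[h *m n]vec3_colE vec3_dot mxE mulr1n !mul0r !addr0 mul1r //.
have m0 : m != 0.
  apply: contraNneq n0 => m0; apply/eqP/(tangent_no_secant hU piE nK) => //.
  by rewrite e1 m0 mulr0.
exists (m^-1 *: n); first by rewrite rationalZ ?fixedV.
exists (m^-1 * (h *m n) 2 0); rewrite -scalemxAr {1}[h *m n]vec3_colE -/m e1 -linearZ /= vec3Z.
by rewrite mulVf // mulrCA mulVf // mulr1.
Qed.

(** Here [v], [a], [b] are prescribed by the splash. Normalised lines through the points of
    coordinates [v], [v + a], [v + b] supply the columns of a rational change of basis that produces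
    exactly these parameters. *)
Lemma tangent_normal_form_of_splash v a b : indep a b ->
  splash l pi = frame_point M |: affine_point M @: coset v a b ->
  exists t r s, normal_mx v a b t r s \in unitmx /\ pi = normal_subplane M v a b t r s.
Proof.
move=> ab spl; have [MU _] := Ml; have [h [hU PK piE]] := tangent_rational_row.
have ray x y : x \in K -> y \in K ->
    exists2 n : 'cV[F]_3, rational n & exists t, h *m n = (vec3 1 (v + (x * a + y * b)) t)^T.
  move=> xK yK; apply: tangent_ray => //; rewrite spl inE; apply/orP; right.
  by apply/imset_f/cosetP; exists x, y.
have [n0 n0K [t0 e0]] := ray 0 0 fixed0 fixed0.
have [n1 n1K [t1 e1]] := ray 1 0 fixed1 fixed0.
have [n2 n2K [t2 e2]] := ray 0 1 fixed0 fixed1.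
(* The columns are [n0], [n1 - n0], [n2 - n0]: applying [h] leaves first entries 1, 0, 0 and second
   entries [v], [a], [b]. *)
pose k : 'M[F]_3 := (\matrix_j [:: n0^T; n1^T - n0^T; n2^T - n0^T]`_j)^T.
have kK : rational k.
  rewrite rational_tr; apply/rationalP=> -[[|[|[|//]]] i] j; rewrite !mxE ?fixedB //;
  by apply/rationalP.
have kE (u : 'cV[F]_3) : k *m u = u 0 0 *: n0 + u 1 0 *: (n1 - n0) + u 2 0 *: (n2 - n0).
  rewrite {1}[u]vec3_colE; move: (u 0 0) (u 1 0) (u 2 0) => x y z.
  apply/matrixP=> i j; rewrite !ord1 !mxE !big_ord_recl big_ord0 !mxE /= ?mxE /=; ring.
have hkE : h *m k = normal_mx v a b t0 (t1 - t0) (t2 - t0).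
  apply: trmx_inj; apply/row_matrixP => j; rewrite -!tr_col; congr trmx.
  rewrite !colE -mulmxA kE; move: (delta_mx _ _) => u.
  rewrite [u in RHS]vec3_colE normal_mx_col !mulmxDr -!scalemxAr !mulmxBr e0 e1 e2.
  by apply/matrixP=> -[[|[|[|//]]] i] i'; rewrite !mxE /=; ring.
have kU : k \in unitmx.
  apply: rational_unitmx => // u; rewrite [u]vec3_colE rational_tr rational_vec3.
  move: (u 0 0) (u 1 0) (u 2 0) => x y z /and3P[_ yK zK] k0.
  have := congr1 (mulmx h) k0; rewrite mulmxA hkE normal_mx_col mulmx0 -trmx0 -vec3_0.
  move/trmx_inj/vec3_inj=> [x0 e _].
  have {}e : y * a + z * b = 0 by rewrite -[RHS]e x0; ring.
  by have [-> ->] := indep_eq0 ab yK zK e; rewrite x0.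
exists t0, (t1 - t0), (t2 - t0); rewrite -hkE unitmx_mul hU kU; split=> //.
by rewrite /normal_subplane -hkE image_subplane_mulr.
Qed.

End TangentSubplane.

(** * Existence of frames *)

Lemma vec3_mul (x y z : F) (t t' r : 'rV[F]_3) :
  vec3 x y z *m (\matrix_i [:: t; t'; r]`_i) = x *: t + y *: t' + z *: r.
Proof.
by apply/rowP=> i; rewrite !mxE !big_ord_recl big_ord0 !mxE /= addr0 addrA.
Qed.

(** Representatives of the two points span [l], and any vector off [l] completes them to a basis in
    which [l] is [z = 0]. *)
Lemma frame_exists l T T' : l \in pg_lines F -> T \in pg_points F -> T' \in pg_points F ->
  (T <= l)%MS -> (T' <= l)%MS -> T != T' ->
  exists M, [/\ frame M l, T = frame_point M & T' = affine_point M 0].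
Proof.
rewrite inE => /andP[_ /eqP rl] /pg_pointsP[t t0 ->] /pg_pointsP[t' t'0 ->].
rewrite !genmxE => tl t'l TT'.
have [i ri] : exists i, ~~ (row i (1%:M : 'M[F]_3) <= l)%MS.
  by apply/row_subPn/negP => /mxrankS; rewrite mxrank1 rl.
set r := row i _ in ri; pose M : 'M[F]_3 := \matrix_i [:: t; t'; r]`_i.
have Ml (u : 'rV_3) : (u *m M <= l)%MS = (u 0 2 == 0).
  rewrite [u in LHS]vec3E vec3_mul; move: (u 0 0) (u 0 1) (u 0 2) => x y z.
  have xyl : ((x *: t + y *: t')%R <= l)%MS by rewrite addmx_sub ?scalemx_sub.
  apply/idP/eqP=> [h|->]; last by rewrite scale0r addr0.
  apply: contraNeq ri => z0; rewrite -(eqmx_scale r z0).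
  rewrite -[z *: r](addKr (x *: t + y *: t')).
  by rewrite addmx_sub ?eqmx_opp.
have MU : M \in unitmx.
  apply: unitmx_rV => u uM; have := Ml u; rewrite uM sub0mx => /esym/eqP u2.
  move: uM; rewrite [u]vec3E u2 vec3_mul scale0r addr0.
  move: (u 0 0) (u 0 1) => x y e.
  have y0 : y = 0.
    apply: contraNeq TT' => y0; apply/eqP/esym/eq_genmx_rank; last by rewrite !rank_rV t0 t'0.
    rewrite -(eqmx_scale t' y0); move/eqP: e; rewrite addrC addr_eq0 => /eqP->.
    by rewrite eqmx_opp scalemx_sub.
  move/eqP: e; rewrite y0 scale0r addr0 scaler_eq0 (negPf t0) orbF => /eqP->.
  exact: vec3_0.
exists M; split=> //.
  by rewrite /frame_point vec3_mul !scale0r !addr0 scale1r.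
by rewrite /affine_point vec3_mul oppr0 !scale0r add0r addr0 scale1r.
Qed.

Lemma exists_other_point l T : l \in pg_lines F -> T \in pg_points F ->
  exists T', [/\ T' \in pg_points F, (T' <= l)%MS & T != T'].
Proof.
rewrite inE => /andP[_ /eqP rl]; rewrite inE => /andP[_ /eqP rT].
have [i ri] : exists i, ~~ (row i l <= T)%MS.
  by apply/row_subPn/negP => /mxrankS; rewrite rl rT.
exists <<row i l>>%MS; rewrite genmxE row_sub; split=> //.
  by apply/pg_pointsP; exists (row i l) => //; apply: contraNneq ri => ->; apply: sub0mx.
by apply: contraNneq ri => ->; rewrite genmxE.
Qed.

Lemma frame_exists_point l T : l \in pg_lines F -> T \in pg_points F -> (T <= l)%MS ->
  exists2 M, frame M l & T = frame_point M.
Proof.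
move=> ll TP Tl; have [T' [T'P T'l TT']] := exists_other_point ll TP.
by have [M [Ml TE _]] := frame_exists ll TP T'P Tl T'l TT'; exists M.
Qed.

(** * A splash determines its centre *)

Definition swap_frame (M : 'M[F]_3) : 'M[F]_3 :=
  (\matrix_i [:: vec3 0 1 0; vec3 1 0 0; vec3 0 0 1]`_i) *m M.

Lemma swap_frameE M x y z : vec3 x y z *m swap_frame M = vec3 y x z *m M.
Proof.
rewrite mulmxA vec3_mul !vec3Z !vec3D; congr (vec3 _ _ _ *m _); ring.
Qed.

Lemma swap_frameP M l : frame M l -> frame (swap_frame M) l.
Proof.
move=> [MU Ml]; split=> [|u].
  apply: unitmx_rV => u; rewrite {1}[u]vec3E swap_frameE => /(canRL (mulmxK MU)).
  by rewrite mul0mx -vec3_0 => /vec3_inj[e1 e0 e2]; rewrite [u]vec3E e0 e1 e2.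
by rewrite {1}[u]vec3E swap_frameE Ml mxE.
Qed.

Lemma swap_frame_point M : frame_point (swap_frame M) = affine_point M 0.
Proof. by rewrite /frame_point /affine_point swap_frameE oppr0. Qed.

Lemma swap_affine_point0 M : affine_point (swap_frame M) 0 = frame_point M.
Proof. by rewrite /frame_point /affine_point swap_frameE oppr0. Qed.

Lemma swap_affine_point M z : z != 0 ->
  affine_point (swap_frame M) z = affine_point M z^-1.
Proof.
move=> z0; rewrite /affine_point swap_frameE.
have -> : vec3 1 (- z) 0 = - z *: vec3 (- z^-1) 1 0.
  by rewrite vec3Z mulrNN mulfV // mulr1 mulr0.
by rewrite -scalemxAl; apply/eq_genmx/eqmx_scale; rewrite oppr_eq0.
Qed.

Lemma coset_through0 v a b : indep a b -> 0 \in coset v a b -> coset v a b = coset 0 a b.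
Proof.
move=> ab v0; apply/esym/eqP; rewrite coset_eqP // v0 /=; apply/andP; split.
  by apply/cosetP; exists 1, 0; rewrite fixed0 fixed1; split=> //; ring.
by apply/cosetP; exists 0, 1; rewrite fixed0 fixed1; split=> //; ring.
Qed.

(* If inversion carried the plane [<a, b>] onto a plane, [1 / (1/a + 1/b)]
   would lie in [<a, b>], which is a quadratic equation for [b / a]. *)
Lemma coset_not_inverse v a b v' a' b' : indep a b -> indep a' b' ->
  0 \in coset v a b -> 0 \in coset v' a' b' ->
  ~ (forall z, z != 0 -> (z \in coset v a b) = (z^-1 \in coset v' a' b')).
Proof.
move=> ab ab' C0 C0'; rewrite (coset_through0 ab C0) (coset_through0 ab' C0') => inv.
have a0 := indep_neq0 ab.
have b0 : b != 0 by apply: contraNneq ab => ->; rewrite mul0r fixed0.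
have aC : a \in coset 0 a b.
  by apply/cosetP; exists 1, 0; rewrite fixed0 fixed1; split=> //; ring.
have bC : b \in coset 0 a b.
  by apply/cosetP; exists 0, 1; rewrite fixed0 fixed1; split=> //; ring.
have ab0 : a + b != 0.
  apply/eqP => e; have [|/eqP] := indep_eq0 ab fixed1 fixed1; first by rewrite !mul1r.
  by rewrite oner_eq0.
have : (a * b / (a + b))^-1 \in coset 0 a' b'.
  move: aC bC; rewrite inv // inv // => /cosetP[x [y [xK yK ea]]].
  move=> /cosetP[x' [y' [xK' yK' eb]]]; apply/cosetP; exists (x + x'), (y + y'); rewrite !fixedD //; split=> //.
  transitivity (a^-1 + b^-1); first by field; rewrite a0 b0 ab0.
  by rewrite ea eb; ring.
rewrite -inv ?mulf_neq0 ?invr_eq0 // => /cosetP[x [y [xK yK e]]].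
have {}e : a * b = (a + b) * (x * a + y * b).
  by rewrite add0r in e; rewrite -e; field.
(* Divided by [a ^+ 2], the relation becomes [x + (x + y - 1) * c + y * c ^+ 2 = 0] with
   [c = b / a]. The vanishing of all coefficients would give [-1 = 0]. *)
have [] := @not_quadratic (b / a) x (x + y - 1) y ab xK _ yK.
- by rewrite fixedB ?fixedD ?fixed1.
- transitivity (((a + b) * (x * a + y * b) - a * b) / a ^+ 2); first by field.
  by rewrite -e subrr mul0r.
by move=> -> h y0; move/eqP: h; rewrite y0 addr0 sub0r oppr_eq0 oner_eq0.
Qed.

Lemma centre_on_line l pi T : pi \in tangent_subplanes q l -> meet l pi = [set T] ->
  T \in pg_points F /\ (T <= l)%MS.
Proof.
case/setIdP=> /imsetP[g gU ->] _ e.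
have {}gU : g \in unitmx by [].
have : T \in meet l (image_subplane g) by rewrite -[image_subplane g]/(_, _) e set11.
rewrite inE => /andP[/(image_pointP _ gU)[u [_ u0 ->]] ->]; split=> //.
by apply/pg_pointsP; exists (u *m g); rewrite ?mulmx_unit_neq0.
Qed.

(** Were the centres distinct, one could be put at [frame_point M] and the other at
    [affine_point M 0]. Each centre lies in the common splash, so both cosets contain 0, and
    swapping the two coordinates makes inversion carry one onto the other, against
    [coset_not_inverse]. *)
Lemma splash_centre l pi pi' T T' : l \in pg_lines F ->
  pi \in tangent_subplanes q l -> pi' \in tangent_subplanes q l ->
  meet l pi = [set T] -> meet l pi' = [set T'] ->
  splash l pi = splash l pi' -> T = T'.
Proof.
move=> ll tp tp' mT mT' spl; apply/eqP; apply: contraT => TT'.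
have [TP Tl] := centre_on_line tp mT; have [T'P T'l] := centre_on_line tp' mT'.
have [M [Ml TE T'E]] := frame_exists ll TP T'P Tl T'l TT'.
have [MU _] := Ml; have Ml' := swap_frameP Ml.
rewrite TE in mT; rewrite T'E -swap_frame_point in mT'.
have [v [a [b [t [r [s [ab NU piE]]]]]]] := tangent_normal_form Ml tp mT.
have [v' [a' [b' [t' [r' [s' [ab' NU' piE']]]]]]] := tangent_normal_form Ml' tp' mT'.
move: spl; rewrite {}piE {}piE' (splash_normal_subplane Ml) // (splash_normal_subplane Ml') //.
move=> /setP spl.
have injM := affine_point_inj MU.
have memC z : (affine_point M z \in frame_point M |: affine_point M @: coset v a b)
   = (z \in coset v a b).
  rewrite in_setU1 mem_imset // -[RHS]orFb; congr (_ || _).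
  by apply/eqP => /esym; apply: frame_point_neq.
have M'U : swap_frame M \in unitmx by case: Ml'.
have memC' z : (affine_point (swap_frame M) z \in
     frame_point (swap_frame M) |: affine_point (swap_frame M) @: coset v' a' b')
   = (z \in coset v' a' b').
  rewrite in_setU1 (mem_imset _ _ (affine_point_inj M'U)) -[RHS]orFb; congr (_ || _).
  by apply/eqP => /esym; apply: frame_point_neq.
case: (@coset_not_inverse v a b v' a' b' ab ab').
- by rewrite -memC spl -swap_frame_point setU11.
- by rewrite -memC' -spl swap_affine_point0 setU11.
by move=> z z0; rewrite -memC -memC' spl swap_affine_point ?invr_eq0 // invrK.
Qed.

(** * Counting splashes and subplanes *)

Lemma tangent_splashes_frame M l : frame M l ->
  tangent_splashes_with_centre q l (frame_point M)
  = (fun C : {set F} => frame_point M |: affine_point M @: C) @: cosets.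
Proof.
move=> Ml; apply/setP=> S; apply/imsetP/imsetP => [[pi]|[C]].
  rewrite inE => /andP[tp /eqP mT] ->.
  have [v [a [b [t [r [s [ab NU ->]]]]]]] := tangent_normal_form Ml tp mT.
  rewrite (splash_normal_subplane Ml) //; exists (coset v a b) => //.
  by apply/imsetP; exists (v, (a, b)); rewrite ?inE.
case/imsetP=> -[v [a b]]; rewrite inE /= => ab -> ->.
(* Any admissible last row realises the coset; with [(0, 0, 1)] the determinant is [a], which is
   nonzero. *)
have NU : normal_mx v a b 0 0 1 \in unitmx.
  by rewrite normal_mx_unit // mulr0 mulr1 (indep_neq0 ab).
exists (normal_subplane M v a b 0 0 1); last by rewrite (splash_normal_subplane Ml).
by rewrite inE normal_subplane_tangent //= meet_normal_subplane.
Qed.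

Lemma splash_of_coset_inj M : M \in unitmx ->
  injective (fun C : {set F} => frame_point M |: affine_point M @: C).
Proof.
move=> MU C C' /setP e; apply/setP=> z; have := e (affine_point M z).
have TF : (affine_point M z == frame_point M) = false.
  by apply/eqP => /esym; apply: frame_point_neq.
by rewrite !in_setU1 TF !mem_imset //; apply: affine_point_inj.
Qed.

Lemma card_splashes_with_centre l T : l \in pg_lines F -> T \in pg_points F ->
  (T <= l)%MS -> #|tangent_splashes_with_centre q l T| = (q * (q ^ 2 + q + 1))%N.
Proof.
move=> ll TP Tl; have [M Ml ->] := frame_exists_point ll TP Tl.
rewrite tangent_splashes_frame // card_imset ?card_cosets //.
by apply: splash_of_coset_inj; case: Ml.
Qed.

Lemma card_points_on_line l : l \in pg_lines F ->
  #|[set T in pg_points F | (T <= l)%MS]| = (q ^ 3 + 1)%N.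
Proof.
move=> ll; have [T TP Tl] : exists2 T, T \in pg_points F & (T <= l)%MS.
  have l0 : l != 0 by move: ll; rewrite inE -mxrank_eq0 => /andP[_ /eqP->].
  have [i i0] := exists_row_neq0 l0; exists <<row i l>>%MS; last by rewrite genmxE row_sub.
  by apply/pg_pointsP; exists (row i l).
have [M Ml _] := frame_exists_point ll TP Tl; have [MU _] := Ml.
have -> : [set T in pg_points F | (T <= l)%MS]
  = frame_point M |: affine_point M @: [set: F].
  apply/setP=> P; rewrite inE in_setU1; apply/(frame_pointsP _ Ml)/orP.
    by case=> [->|[z ->]]; [left|right; apply: imset_f].
  by case=> [/eqP->|/imsetP[z _ ->]]; [left|right; exists z].
rewrite cardsU1 card_imset; last exact: affine_point_inj.
rewrite cardsT cardF addnC; congr (_ + _)%N; apply/eqP; rewrite eqb1.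
by apply/imsetP=> -[z _ /(frame_point_neq MU)].
Qed.

(** By [splash_centre] the sets of splashes with different centres are disjoint, so the counts for
    the [q ^ 3 + 1] points of [l] add up. *)
Lemma card_tangent_splashes l : l \in pg_lines F ->
  #|tangent_splashes q l| = (q * (q ^ 3 + 1) * (q ^ 2 + q + 1))%N.
Proof.
move=> ll.
have -> : tangent_splashes q l = \bigcup_T tangent_splashes_with_centre q l T.
  apply/setP=> S; apply/imsetP/bigcupP => [[pi tp ->]|[T _ /imsetP[pi]]].
    have /cards1P[T mT] : #|meet l pi| == 1%N by case/setIdP: tp.
    by exists T => //; apply/imsetP; exists pi; rewrite // inE tp mT eqxx.
  by rewrite inE => /andP[tp _] ->; exists pi.
rewrite -sum1_card partition_disjoint_bigcup /=; last first.
  move=> T T'; apply: contraR => /pred0Pn[S /= /andP[/imsetP[pi]]].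
  rewrite inE => /andP[tp /eqP mT] -> /imsetP[pi']; rewrite inE => /andP[tp' /eqP mT'] e.
  by apply/eqP/(splash_centre ll tp tp').
(* The union ranges over all matrices [T]; those that are not points of [l] are the centre of no
   splash and contribute 0. *)
rewrite (bigID (fun T => T \in [set T in pg_points F | (T <= l)%MS])) /=.
rewrite [X in (_ + X)%N]big1 ?addn0 => [|T TN]; last first.
  rewrite sum1_card; apply/eqP; rewrite cards_eq0; apply/eqP/setP => S; rewrite in_set0.
  apply: contraNF TN => /imsetP[pi]; rewrite inE => /andP[tp /eqP mT] _.
  by have [TP Tl] := centre_on_line tp mT; rewrite inE TP.
rewrite (eq_bigr (fun=> (q * (q ^ 2 + q + 1))%N)); last first.
  by move=> T; rewrite inE => /andP[TP Tl]; rewrite sum1_card card_splashes_with_centre.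
by rewrite sum_nat_const card_points_on_line //; ring.
Qed.

(** For each [r] exactly one [s] is excluded, namely [b * r / a], while [t] is free: this leaves
    [q ^ 3 * (q ^ 6 - q ^ 3)] triples. *)
Lemma card_det_neq0 (a b : F) : a != 0 ->
  #|[set trs : F * (F * F) | a * trs.2.2 != b * trs.2.1]| = (q ^ 6 * (q ^ 3 - 1))%N.
Proof.
move=> a0.
have -> : [set trs : F * (F * F) | a * trs.2.2 != b * trs.2.1]
   = setX setT (~: [set (r, b * r / a) | r in [set: F]]).
  apply/setP=> -[t [r s]]; rewrite !inE /=; congr (~~ _).
  apply/eqP/imsetP=> [e|[r' _ [-> ->]]]; last by field.
  by exists r => //; congr pair; rewrite -e; field.
rewrite cardsX cardsT cardF cardsCs setCK card_imset; last by move=> r r' [].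
by rewrite card_prod cardsT cardF mulnBr mulnBr muln1 -!expnD.
Qed.

(** All subplanes with this splash share its centre, so one frame and one choice of [v], [a], [b]
    serve for all of them. They are then in bijection with the last rows [(t, r, s)] that make the
    normal matrix invertible. *)
Lemma card_subplanes_with_splash l S : l \in pg_lines F -> S \in tangent_splashes q l ->
  #|[set pi in tangent_subplanes q l | splash l pi == S]| = (q ^ 6 * (q ^ 3 - 1))%N.
Proof.
move=> ll /imsetP[pi0 tp0 ->].
have /cards1P[T mT] : #|meet l pi0| == 1%N by case/setIdP: tp0.
have [TP Tl] := centre_on_line tp0 mT.
have [M Ml TE] := frame_exists_point ll TP Tl; rewrite TE in mT.
have [v [a [b [t0 [r0 [s0 [ab NU0 pi0E]]]]]]] := tangent_normal_form Ml tp0 mT.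
have spl0 := splash_normal_subplane Ml ab NU0; rewrite -pi0E in spl0.
rewrite -(card_det_neq0 b (indep_neq0 ab)).
rewrite -(@card_in_imset _ _ (fun trs => normal_subplane M v a b trs.1 trs.2.1 trs.2.2)).
  apply: eq_card => pi; apply/setIdP/imsetP => [[tp /eqP spl]|[[t [r s]]]].
    have /cards1P[T' mT'] : #|meet l pi| == 1%N by case/setIdP: tp.
    have T'E : frame_point M = T' by apply: (splash_centre ll tp0 tp) => //.
    rewrite -T'E in mT'.
    have [t [r [s [NU piE]]]] := tangent_normal_form_of_splash Ml tp mT' ab (etrans spl spl0).
    by exists (t, (r, s)) => //; rewrite inE /= -(normal_mx_unit v t r s ab).
  rewrite inE /= => ne ->.
  have NU : normal_mx v a b t r s \in unitmx by rewrite normal_mx_unit.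
  by rewrite normal_subplane_tangent // splash_normal_subplane // spl0.
move=> [t [r s]] [t' [r' s']]; rewrite !inE /= => ne ne'.
move=> /normal_subplane_inj-[||||-> -> ->] //.
- by case: Ml.
- by rewrite normal_mx_unit.
- by rewrite normal_mx_unit.
Qed.
End RationalPlanes.

Theorem theorem5p2 (F : finFieldType) (q : nat)
    (q_prime_power : exists p k : nat, [/\ prime p, 0 < k & q = p ^ k])
    (cardF : #|F| = q ^ 3) (l : 'M[F]_3) (l_line : l \in pg_lines F) :
  [/\ forall S : {set 'M[F]_3}, S \in tangent_splashes q l ->
        #|[set pi in tangent_subplanes q l | splash l pi == S]|
          = q ^ 6 * (q ^ 3 - 1),
      #|tangent_splashes q l| = q * (q ^ 3 + 1) * (q ^ 2 + q + 1)
    & forall T : 'M[F]_3, T \in pg_points F -> (T <= l)%MS ->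
        #|tangent_splashes_with_centre q l T| = q * (q ^ 2 + q + 1) ].
Proof.
have [phi phiE] := exists_base_frobenius q_prime_power cardF.
have phi3 x : phi (phi (phi x)) = x by rewrite !phiE expf_base_order3.
have cardK : #|fixed_field phi| = q.
  by rewrite -[RHS](card_base_field q_prime_power cardF); apply: eq_card => x; rewrite !inE phiE.
have q_gt1 := base_order_gt1 q_prime_power.
split=> [S SP||T TP Tl].
- exact: (card_subplanes_with_splash phi3 cardF cardK).
- exact: (card_tangent_splashes phi3 cardF cardK).
- exact: (card_splashes_with_centre cardF cardK).
Qed.
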